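(* $\pi_{5.1}(\emptyset)=\pi_{5.9}(\emptyset)=\dfrac{5}{8}$.
   Context: A $3$-graph is a pair $G=(V,E)$ with $E$ a set of $3$-element subsets of $V$. For integers $m,k$, $m.k$ denotes the family of all $3$-graphs on $m$ vertices with exactly $k$ edges (so $5.9$ consists of the $3$-graph obtained from the complete $3$-graph on $5$ vertices by deleting one edge). For a $3$-graph $G$ on $n\ge m$ vertices, $e_{m.k}(G)$ is the number of $m$-element subsets of $V(G)$ spanning exactly $k$ edges of $G$, and $\pi_{m.k}(\emptyset)=\lim_{n\to\infty}\max\{e_{m.k}(G): |V(G)|=n\}/\binom{n}{m}$ (the limit exists). *)

(* Defs.v *)
From HB Require Import structures.
From mathcomp Require Import all_boot all_order all_algebra.
From mathcomp Require Import all_classical all_reals all_analysis.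

Set Implicit Arguments.
Unset Strict Implicit.
Unset Printing Implicit Defensive.

Import Order.TTheory GRing.Theory Num.Theory.
Import numFieldNormedType.Exports.
Record three_graph (V : finType) := ThreeGraph {
  edges :> {set {set V}};
  edges_card3 : [forall e in edges, #|e| == 3]
}.

HB.instance Definition _ (V : finType) := [isSub for @edges V].
HB.instance Definition _ (V : finType) := [Finite of three_graph V by <:].

Definition spanned_edges (V : finType) (G : three_graph V) (S : {set V}) :
  {set {set V}} := [set e in edges G | e \subset S].

Definition e_count (m k : nat) (V : finType) (G : three_graph V) : nat :=
  #|[set S : {set V} | (#|S| == m) && (#|spanned_edges G S| == k)]|.

Definition max_e_count (m k n : nat) : nat :=
  \max_(G : three_graph 'I_n) e_count m k G.

Local Open Scope classical_set_scope.
Local Open Scope ring_scope.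

Definition max_density (R : realType) (m k : nat) : R^nat :=
  fun n => (max_e_count m k n)%:R / ('C(n, m))%:R.

(* [lim] is total, with value 0 on divergent sequences: an equality between  *)
(* [pi_empty] and a nonzero number entails convergence, as recorded in       *)
(* [pi_empty_cvg].                                                           *)
Definition pi_empty (R : realType) (m k : nat) : R :=
  lim (max_density R m k @ \oo).

Lemma pi_empty_cvg (R : realType) (m k : nat) (l : R) :
  l != 0 -> pi_empty R m k = l -> max_density R m k @ \oo --> l.
Proof.
move=> l0 pil.
have [c|nc] := pselect (cvg (max_density R m k @ \oo)).
  by rewrite -pil.
by move: l0; rewrite -pil /pi_empty (dvgP nc) /point /= eqxx.
Qed.

(* Main.v *)
From Stdlib Require Import ZArith.
Require Import Defs.
From mathcomp Require Import all_boot all_order all_algebra.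
From mathcomp Require Import boolp.
From mathcomp Require Import ring lra zify ssrZ.

Set Implicit Arguments.
Unset Strict Implicit.
Unset Printing Implicit Defensive.

Import Order.TTheory GRing.Theory Num.Theory.

Delimit Scope Z_scope with BZ.

(** Complementation exchanges 5.1 and 5.9.  For 5.1 the lower bound comes from two
    disjoint cliques of equal size.  The upper bound is a sum-of-squares certificate:
    every 3-graph on six vertices satisfies
      [45 - 12 N - P - 6 Q >= 0],
    where [N] counts its 5-subsets spanning one edge, [P] sums [W W' + 2 U U' + 4 B B']
    over the 45 ways to choose a pair [ab] and to split the other four vertices into
    pairs [xy], [zw] (with [W = W(ab; xy)], [W' = W(ab; zw)], ...), and [Q] sums
    [C(d) C(f)] over the 90 ways to choose [pq], [rs], [df].  As this holds for every
    0/1 pattern, it can be summed over all 6-tuples of vertices, repetitions included,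
    without error terms; then [P] and [Q] become sums of squares and
    [8 * #{5-tuples spanning one edge} <= 5 * n^5] remains.  The inequality on six
    vertices is checked by computation; a descent along adjacent transpositions
    of the first five vertices leaves 46 * 1024 graphs. *)

(** * The certificate and its symmetries *)

(* For a pair [ab], [flagW], [flagU] and [flagB] are functions of the pair [xy],
   given by the four possible edges on [a, b, x, y]; for [p, q, r, s] spanning
   exactly the edges [prs] and [qrs] ([typeC]), [flagC] is a function of a further
   vertex [d].  They come from rounding a numerical solution of the flag-algebra
   semidefinite program on six vertices: for two disjoint
   cliques of equal size all of them average to zero, so the squares cost nothing. *)
Definition flagW (abx aby axy bxy : bool) : Z :=
  match abx, aby, axy, bxy with
  | false, false, false, false | true, true, true, true => 1
  | true, false, false, false | false, true, false, false
  | false, false, true, false | false, false, false, true => -1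
  | true, true, false, false => -2
  | _, _, _, _ => 0
  end%BZ.

Definition flagU (abx aby axy bxy : bool) : Z :=
  match abx, aby, axy, bxy with
  | true, true, false, false => 1
  | false, false, true, true => -1
  | _, _, _, _ => 0
  end%BZ.

Definition flagB (abx aby axy bxy : bool) : Z :=
  match abx, aby, axy, bxy with
  | false, false, true, false => 1
  | false, false, false, true => -1
  | _, _, _, _ => 0
  end%BZ.

Definition typeC (pqr pqs prs qrs : bool) : bool :=
  [&& ~~ pqr, ~~ pqs, prs & qrs].

Definition flagC (prd psd qrd qsd rsd pqd : bool) : Z :=
  if [|| prd, psd, qrd, qsd | rsd] then 0%BZ else if pqd then (-1)%BZ else 1%BZ.

Fixpoint exactly_one (l : seq bool) : bool :=
  if l is b :: l' then (if b then ~~ has id l' else exactly_one l') else false.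

Definition symmetric3 (I : Type) (e : I -> I -> I -> bool) :=
  (forall x y z, e x y z = e y x z) /\ (forall x y z, e x y z = e x z y).

Definition on_four (I : Type) (e : I -> I -> I -> bool)
  (f : bool -> bool -> bool -> bool -> Z) (a b x y : I) : Z :=
  f (e a b x) (e a b y) (e a x y) (e b x y).

Definition pair_term (I : Type) (e : I -> I -> I -> bool) (a b x y z w : I) : Z :=
  (on_four e flagW a b x y * on_four e flagW a b z w
   + 2 * (on_four e flagU a b x y * on_four e flagU a b z w)
   + 4 * (on_four e flagB a b x y * on_four e flagB a b z w))%BZ.

Definition quad_type (I : Type) (e : I -> I -> I -> bool) (p q r s : I) : bool :=
  typeC (e p q r) (e p q s) (e p r s) (e q r s).

Definition quad_flag (I : Type) (e : I -> I -> I -> bool) (p q r s d : I) : Z :=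
  flagC (e p r d) (e p s d) (e q r d) (e q s d) (e r s d) (e p q d).

Definition quad_term (I : Type) (e : I -> I -> I -> bool) (p q r s d f : I) : Z :=
  if quad_type e p q r s
  then (quad_flag e p q r s d * quad_flag e p q r s f)%BZ else 0%BZ.

Definition one_edge (I : Type) (e : I -> I -> I -> bool) (a b c d f : I) : bool :=
  exactly_one [:: e a b c; e a b d; e a c d; e b c d; e a b f; e a c f; e b c f;
    e a d f; e b d f; e c d f].

Definition five_term (I : Type) (e : I -> I -> I -> bool) (a b c d f g : I) : Z :=
  if one_edge e a b c d f then 1%BZ else 0%BZ.

Lemma exactly_oneE (l : seq bool) : exactly_one l = (count id l == 1).
Proof.
elim: l => //= -[] l IHl //=.
by rewrite has_count -leqNgt leqn0.
Qed.

(** Exchanging [a] and [b] changes the sign of [flagB], but in both factors at once; [flagW] and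
    [flagU] do not change. Exchanging [x] and [y], or [z] and [w], fixes all three flags. *)
Lemma pair_term_sym (I : Type) (e : I -> I -> I -> bool) a b x y z w :
  symmetric3 e ->
  [/\ pair_term e b a x y z w = pair_term e a b x y z w,
      pair_term e a b y x z w = pair_term e a b x y z w,
      pair_term e a b x y w z = pair_term e a b x y z w &
      pair_term e a b z w x y = pair_term e a b x y z w].
Proof.
move=> [s12 s23]; rewrite /pair_term /on_four; split.
- by rewrite ![e b a _]s12; do 8!case: (e _ _ _).
- by rewrite ![e _ y x]s23; do 8!case: (e _ _ _).
- by rewrite ![e _ w z]s23; do 8!case: (e _ _ _).
- by do 8!case: (e _ _ _).
Qed.

Lemma quad_term_sym (I : Type) (e : I -> I -> I -> bool) p q r s d f :
  symmetric3 e ->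
  [/\ quad_term e q p r s d f = quad_term e p q r s d f,
      quad_term e p q s r d f = quad_term e p q r s d f &
      quad_term e p q r s f d = quad_term e p q r s d f].
Proof.
move=> [s12 s23].
rewrite /quad_term /quad_type /typeC /quad_flag /flagC; split.
- rewrite ![e q p _]s12 [e q r s && _]andbC.
  by case: ifP => // _; congr (_ * _)%BZ; do 4!case: (e _ _ _).
- rewrite ![e _ s r]s23 ![e s r _]s12 [~~ e p q s && _]andbCA.
  by case: ifP => // _; congr (_ * _)%BZ; do 4!case: (e _ _ _).
- by rewrite Z.mul_comm.
Qed.

Lemma five_term_sym (I : Type) (e : I -> I -> I -> bool) a b c d f g :
  symmetric3 e ->
  [/\ five_term e b a c d f g = five_term e a b c d f g,
      five_term e a c b d f g = five_term e a b c d f g,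
      five_term e a b d c f g = five_term e a b c d f g &
      five_term e a b c f d g = five_term e a b c d f g].
Proof.
move=> [s12 s23]; rewrite /five_term /one_edge !exactly_oneE /= !addn0.
split; congr (if _ == _ then _ else _).
- by rewrite ![e b a _]s12; ring.
- by rewrite ![e _ c b]s23 ![e c b _]s12; ring.
- by rewrite ![e _ d c]s23 ![e d c _]s12; ring.
- by rewrite ![e _ f d]s23; ring.
Qed.

(** * Placements of the terms on six vertices *)

Definition eval6 (A I : Type) (f : I -> I -> I -> I -> I -> I -> A)
  (x : nat -> I) : A := f (x 0) (x 1) (x 2) (x 3) (x 4) (x 5).

Definition perms6 := permutations (iota 0 6).

Definition compose (s t : seq nat) := [seq nth 0 s i | i <- t].

Definition relabel (e : nat -> nat -> nat -> bool) (s : seq nat) i j k :=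
  e (nth 0 s i) (nth 0 s j) (nth 0 s k).

(* One ordering for each choice of a 5-set, of [ab] with an unordered pair of pairs
   [xy], [zw], and of unordered pairs [pq], [rs], [df]. *)
Definition five_placements := [seq s <- perms6 | sorted ltn (take 5 s)].

Definition pair_placements := [seq s <- perms6 |
  [&& nth 0 s 0 < nth 0 s 1, nth 0 s 2 < nth 0 s 3,
      nth 0 s 4 < nth 0 s 5 & nth 0 s 2 < nth 0 s 4]].

Definition quad_placements := [seq s <- perms6 |
  [&& nth 0 s 0 < nth 0 s 1, nth 0 s 2 < nth 0 s 3 & nth 0 s 4 < nth 0 s 5]].

(** A fold with the operations of [Z], which evaluates, whereas a big operator is locked. *)
Definition sum_over (l : seq (seq nat))
    (f : nat -> nat -> nat -> nat -> nat -> nat -> Z) : Z :=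
  foldr (fun s z => eval6 f (nth 0%N s) + z)%BZ 0%BZ l.

(** The constants carry the bound: averaged over 6-tuples, with the last two terms at most zero, the
    density of 5-tuples spanning one edge is at most 45 / (12 * 6) = 5 / 8. *)
Definition weighted (n5 n2 n4 : Z) : Z := (45 - 12 * n5 - n2 - 6 * n4)%BZ.

Definition local_form (e : nat -> nat -> nat -> bool) : Z :=
  weighted (sum_over five_placements (five_term e))
    (sum_over pair_placements (pair_term e)) (sum_over quad_placements (quad_term e)).

Lemma sum_overE l f :
  sum_over l f = (\sum_(s <- l) eval6 f (nth 0%N s))%R.
Proof. by elim: l => [|s l IHl]; rewrite ?big_nil // big_cons -IHl. Qed.

Definition transpositions : seq (seq nat) :=
  [:: [:: 1; 0; 2; 3; 4; 5]; [:: 0; 2; 1; 3; 4; 5];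
      [:: 0; 1; 3; 2; 4; 5]; [:: 0; 1; 2; 4; 3; 5]].

(* If no symmetry of [A] brings [s] into [L], the value is [s] itself. *)
Definition canonical (L A : seq (seq nat)) (s : seq nat) : seq nat :=
  let orb := [seq compose s a | a <- A] in nth s orb (find (mem L) orb).

(** Relabelling by [t] turns the placement [s] into [compose t s]. A symmetry of the term brings
    this back into [L] without changing its value, and [L] is only permuted. *)
Lemma sum_over_relabel (F : (nat -> nat -> nat -> bool) ->
    nat -> nat -> nat -> nat -> nat -> nat -> Z) (L A : seq (seq nat)) e t :
  (forall x, eval6 (F (relabel e t)) x = eval6 (F e) (fun i => nth 0%N t (x i))) ->
  (forall s a, a \in A ->
     eval6 (F e) (nth 0%N (compose s a)) = eval6 (F e) (nth 0%N s)) ->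
  all (fun s => size s == 6) L ->
  perm_eq [seq canonical L A (compose t s) | s <- L] L ->
  sum_over L (F (relabel e t)) = sum_over L (F e).
Proof.
move=> Frel FA L6 pL; rewrite !sum_overE -[RHS](perm_big _ pL) big_map.
rewrite !big_seq; apply: eq_bigr => s /(allP L6) s6; rewrite Frel.
have -> : eval6 (F e) (nth 0%N (canonical L A (compose t s))) =
          eval6 (F e) (nth 0%N (compose t s)).
  rewrite /canonical; set orb := map _ _.
  case: (ltnP (find (mem L) orb) (size orb)) => [lt|ge]; last by rewrite nth_default.
  by have /mapP[a aA ->] := mem_nth (compose t s) lt; rewrite FA.
(* The size matters: past the end of [s], [compose t s] has default 0, while reading [s] and then
   [t] gives the first entry of [t]. *)
case: s s6 => [|? [|? [|? [|? [|? [|? []]]]]]] //.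
Qed.

(** An adjacent transposition breaks at most one of the order conditions defining a placement, so
    single generators suffice and whole symmetry groups are not searched. *)
Definition five_sym := iota 0 6 :: transpositions.
Definition pair_sym : seq (seq nat) :=
  [:: iota 0 6; [:: 1; 0; 2; 3; 4; 5]; [:: 0; 1; 3; 2; 4; 5];
      [:: 0; 1; 2; 3; 5; 4]; [:: 0; 1; 4; 5; 2; 3]].
Definition quad_sym : seq (seq nat) :=
  [:: iota 0 6; [:: 1; 0; 2; 3; 4; 5]; [:: 0; 1; 3; 2; 4; 5]; [:: 0; 1; 2; 3; 5; 4]].

Lemma placements_closed (t : seq nat) : t \in transpositions ->
  [&& perm_eq [seq canonical five_placements five_sym (compose t s)
              | s <- five_placements] five_placements,
      perm_eq [seq canonical pair_placements pair_sym (compose t s)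
              | s <- pair_placements] pair_placements &
      perm_eq [seq canonical quad_placements quad_sym (compose t s)
              | s <- quad_placements] quad_placements].
Proof.
apply/allP: t.
by vm_compute.
Qed.

Lemma size_perms6 (P : pred (seq nat)) :
  all (fun s => size s == 6) [seq s <- perms6 | P s].
Proof.
apply/allP => s; rewrite mem_filter => /andP[_].
by rewrite mem_permutations => /perm_size->.
Qed.

Lemma local_form_relabel e t : symmetric3 e -> t \in transpositions ->
  local_form (relabel e t) = local_form e.
Proof.
move=> syme tT; have /and3P[p5 p2 p4] := placements_closed tT.
congr weighted.
- apply: (@sum_over_relabel (@five_term nat) _ five_sym) p5 => [x|s a|].
  + reflexivity.
  + have [h1 h2 h3 h4] := five_term_sym (nth 0 s 0) (nth 0 s 1) (nth 0 s 2)
      (nth 0 s 3) (nth 0 s 4) (nth 0 s 5) syme.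
    rewrite !inE => /or4P[||| /orP[]] /eqP->; rewrite /eval6 /=;
    [reflexivity | exact h1 | exact h2 | exact h3 | exact h4].
  + exact: size_perms6.
- apply: (@sum_over_relabel (@pair_term nat) _ pair_sym) p2 => [x|s a|].
  + reflexivity.
  + have [h1 h2 h3 h4] := pair_term_sym (nth 0 s 0) (nth 0 s 1) (nth 0 s 2)
      (nth 0 s 3) (nth 0 s 4) (nth 0 s 5) syme.
    rewrite !inE => /or4P[||| /orP[]] /eqP->; rewrite /eval6 /=;
    [reflexivity | exact h1 | exact h2 | exact h3 | exact h4].
  + exact: size_perms6.
- apply: (@sum_over_relabel (@quad_term nat) _ quad_sym) p4 => [x|s a|].
  + reflexivity.
  + have [h1 h2 h3] := quad_term_sym (nth 0 s 0) (nth 0 s 1) (nth 0 s 2)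
      (nth 0 s 3) (nth 0 s 4) (nth 0 s 5) syme.
    rewrite !inE => /or4P[] /eqP->; rewrite /eval6 /=;
    [reflexivity | exact h1 | exact h2 | exact h3].
  + exact: size_perms6.
Qed.

(** * The inequality on six vertices *)

(** Reads distinct vertices in increasing order, so that a symmetric relation enters the computation
    through twenty bits only. *)
Definition sorted3 (e : nat -> nat -> nat -> bool) (i j k : nat) : bool :=
  if i < j then
    if j < k then e i j k else if i < k then e i k j else e k i j
  else
    if i < k then e j i k else if j < k then e j k i else e k j i.

Lemma sorted3_id e : symmetric3 e -> sorted3 e = e.
Proof.
move=> [s12 s23]; apply/funext => i; apply/funext => j; apply/funext => k.
rewrite /sorted3; do !case: ifP => // _.
- by rewrite s12 s23.
- by rewrite s23 s12.
- by rewrite s12 s23 s12.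
Qed.

(** The ten triples of the first five vertices as binary digits: the measure of the descent. *)
Definition code (e : nat -> nat -> nat -> bool) : N :=
  foldl (fun n b => if b then N.succ_double n else N.double n) 0%num
    [:: e 0 1 2; e 0 1 3; e 0 2 3; e 1 2 3; e 0 1 4;
        e 0 2 4; e 1 2 4; e 0 3 4; e 1 3 4; e 2 3 4].

(** Minimality under adjacent transpositions only: weaker than being least in the orbit, but cheap
    to test and enough for a descent. *)
Definition code_minimal (e : nat -> nat -> nat -> bool) : bool :=
  all (fun t => N.leb (code e) (code (relabel e t))) transpositions.

Definition of_bits (b012 b013 b023 b123 b014 b024 b124 b034 b134 b234
    b015 b025 b125 b035 b135 b235 b045 b145 b245 b345 : bool) (i j k : nat) :=
  match i, j, k with
  | 0, 1, 2 => b012 | 0, 1, 3 => b013 | 0, 2, 3 => b023 | 1, 2, 3 => b123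
  | 0, 1, 4 => b014 | 0, 2, 4 => b024 | 1, 2, 4 => b124 | 0, 3, 4 => b034
  | 1, 3, 4 => b134 | 2, 3, 4 => b234 | 0, 1, 5 => b015 | 0, 2, 5 => b025
  | 1, 2, 5 => b125 | 0, 3, 5 => b035 | 1, 3, 5 => b135 | 2, 3, 5 => b235
  | 0, 4, 5 => b045 | 1, 4, 5 => b145 | 2, 4, 5 => b245 | 3, 4, 5 => b345
  | _, _, _ => false
  end.

(** A row lists the edges that a term reads, apart from the arithmetic on them, so that the
    placements can be evaluated once with the edges still variables. *)
Definition five_row (I : Type) (e : I -> I -> I -> bool) (a b c d f _ : I) :=
  [:: e a b c; e a b d; e a c d; e b c d; e a b f; e a c f; e b c f;
      e a d f; e b d f; e c d f].

Definition pair_row (I : Type) (e : I -> I -> I -> bool) (a b x y z w : I) :=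
  [:: e a b x; e a b y; e a x y; e b x y; e a b z; e a b w; e a z w; e b z w].

Definition quad_row (I : Type) (e : I -> I -> I -> bool) (p q r s d f : I) :=
  [:: e p q r; e p q s; e p r s; e q r s;
      e p r d; e p s d; e q r d; e q s d; e r s d; e p q d;
      e p r f; e p s f; e q r f; e q s f; e r s f; e p q f].

Definition five_value (l : seq bool) : Z := if exactly_one l then 1%BZ else 0%BZ.

Definition pair_value (l : seq bool) : Z :=
  if l is [:: b1; b2; b3; b4; c1; c2; c3; c4] then
    (flagW b1 b2 b3 b4 * flagW c1 c2 c3 c4
     + 2 * (flagU b1 b2 b3 b4 * flagU c1 c2 c3 c4)
     + 4 * (flagB b1 b2 b3 b4 * flagB c1 c2 c3 c4))%BZ
  else 0%BZ.

Definition quad_value (l : seq bool) : Z :=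
  if l is [:: t1; t2; t3; t4; b1; b2; b3; b4; b5; b6; c1; c2; c3; c4; c5; c6] then
    if typeC t1 t2 t3 t4
    then (flagC b1 b2 b3 b4 b5 b6 * flagC c1 c2 c3 c4 c5 c6)%BZ else 0%BZ
  else 0%BZ.

Definition sum_rows (v : seq bool -> Z) (l : seq (seq bool)) : Z :=
  foldr (fun r z => v r + z)%BZ 0%BZ l.

Definition rows (row : nat -> nat -> nat -> nat -> nat -> nat -> seq bool)
  (L : seq (seq nat)) := [seq eval6 row (nth 0 s) | s <- L].

Lemma sum_rowsE v row f L :
  (forall x, eval6 f x = v (eval6 row x)) ->
  sum_over L f = sum_rows v (rows row L).
Proof. by move=> fv; elim: L => //= s L IHL; rewrite fv -/(sum_over L f) IHL. Qed.

Definition rows_form (l5 l2 l4 : seq (seq bool)) : Z :=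
  weighted (sum_rows five_value l5) (sum_rows pair_value l2) (sum_rows quad_value l4).

Lemma local_formE e : local_form e =
  rows_form (rows (five_row e) five_placements) (rows (pair_row e) pair_placements)
    (rows (quad_row e) quad_placements).
Proof.
rewrite /local_form /rows_form.
(* Otherwise unification computes the placements to tell them apart. *)
move: five_placements pair_placements quad_placements => L5 L2 L4.
rewrite (@sum_rowsE five_value (five_row e)) //.
by rewrite (@sum_rowsE pair_value (pair_row e)) // (@sum_rowsE quad_value (quad_row e)).
Qed.

(* The partial evaluation turns the rows into explicit lists of bits; without it
   the placements would be recomputed for every graph. *)
Definition five_bits := Eval cbv in
  fun b012 b013 b023 b123 b014 b024 b124 b034 b134 b234
      b015 b025 b125 b035 b135 b235 b045 b145 b245 b345 =>
  rows (five_row (sorted3 (of_bits b012 b013 b023 b123 b014 b024 b124 b034 b134 b234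
      b015 b025 b125 b035 b135 b235 b045 b145 b245 b345))) five_placements.

Definition pair_bits := Eval cbv in
  fun b012 b013 b023 b123 b014 b024 b124 b034 b134 b234
      b015 b025 b125 b035 b135 b235 b045 b145 b245 b345 =>
  rows (pair_row (sorted3 (of_bits b012 b013 b023 b123 b014 b024 b124 b034 b134 b234
      b015 b025 b125 b035 b135 b235 b045 b145 b245 b345))) pair_placements.

Definition quad_bits := Eval cbv in
  fun b012 b013 b023 b123 b014 b024 b124 b034 b134 b234
      b015 b025 b125 b035 b135 b235 b045 b145 b245 b345 =>
  rows (quad_row (sorted3 (of_bits b012 b013 b023 b123 b014 b024 b124 b034 b134 b234
      b015 b025 b125 b035 b135 b235 b045 b145 b245 b345))) quad_placements.

Definition bits_form b012 b013 b023 b123 b014 b024 b124 b034 b134 b234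
    b015 b025 b125 b035 b135 b235 b045 b145 b245 b345 :=
  rows_form
    (five_bits b012 b013 b023 b123 b014 b024 b124 b034 b134 b234
      b015 b025 b125 b035 b135 b235 b045 b145 b245 b345)
    (pair_bits b012 b013 b023 b123 b014 b024 b124 b034 b134 b234
      b015 b025 b125 b035 b135 b235 b045 b145 b245 b345)
    (quad_bits b012 b013 b023 b123 b014 b024 b124 b034 b134 b234
      b015 b025 b125 b035 b135 b235 b045 b145 b245 b345).

(** Triples through vertex 5 may be set to [false]: [code] does not read them and the transpositions
    fix 5. *)
Definition minimal_bits b012 b013 b023 b123 b014 b024 b124 b034 b134 b234 :=
  code_minimal (sorted3 (of_bits b012 b013 b023 b123 b014 b024 b124 b034 b134 b234
    false false false false false false false false false false)).

Definition allb (f : bool -> bool) := if f true then f false else false.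

Lemma allbP f : allb f -> forall b, f b.
Proof. by rewrite /allb; case E: (f true) => //= ? []. Qed.

(** The test is an [if] because call-by-value evaluation of [==>] would compute the inner loops even
    for codes that are not minimal. *)
Definition bits_check : bool :=
  allb (fun b012 => allb (fun b013 => allb (fun b023 => allb (fun b123 =>
  allb (fun b014 => allb (fun b024 => allb (fun b124 => allb (fun b034 =>
  allb (fun b134 => allb (fun b234 =>
  if minimal_bits b012 b013 b023 b123 b014 b024 b124 b034 b134 b234 then
    allb (fun b015 => allb (fun b025 => allb (fun b125 => allb (fun b035 =>
    allb (fun b135 => allb (fun b235 => allb (fun b045 => allb (fun b145 =>
    allb (fun b245 => allb (fun b345 =>
    Z.leb 0 (bits_form b012 b013 b023 b123 b014 b024 b124 b034 b134 b234
      b015 b025 b125 b035 b135 b235 b045 b145 b245 b345)))))))))))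
  else true)))))))))).

Lemma bits_check_true : bits_check.
Proof. by vm_compute. Qed.

(** On distinct numerals [sorted3 e] reduces to [e] at an increasing triple, so the rows agree by
    computation. *)
Lemma bits_formE e :
  local_form (sorted3 e) =
  bits_form (e 0 1 2) (e 0 1 3) (e 0 2 3) (e 1 2 3) (e 0 1 4)
    (e 0 2 4) (e 1 2 4) (e 0 3 4) (e 1 3 4) (e 2 3 4)
    (e 0 1 5) (e 0 2 5) (e 1 2 5) (e 0 3 5) (e 1 3 5)
    (e 2 3 5) (e 0 4 5) (e 1 4 5) (e 2 4 5) (e 3 4 5).
Proof. by rewrite local_formE; congr rows_form. Qed.

Lemma code_minimalE e :
  code_minimal (sorted3 e) = minimal_bits (e 0 1 2) (e 0 1 3) (e 0 2 3) (e 1 2 3)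
    (e 0 1 4) (e 0 2 4) (e 1 2 4) (e 0 3 4) (e 1 3 4) (e 2 3 4).
Proof. reflexivity. Qed.

Lemma relabel_symmetric3 e s : symmetric3 e -> symmetric3 (relabel e s).
Proof. by move=> [s12 s23]; split=> i j k; rewrite /relabel. Qed.

(** Induction on [code]: a transposition that lowers it preserves [local_form], and a relation that
    none of them lowers is covered by [bits_check]. *)
Lemma local_form_ge0 e : symmetric3 e -> (0 <= local_form e)%BZ.
Proof.
have [n] := ubnP (N.to_nat (code e)).
elim: n e => // n IHn e len syme.
have [min|] := boolP (code_minimal e).
  have E := sorted3_id syme.
  rewrite -E bits_formE.
  rewrite -E code_minimalE in min.
  apply/Z.leb_le.
  have := bits_check_true.
  move/allbP=> /(_ (e 0 1 2)) /allbP/(_ (e 0 1 3)) /allbP/(_ (e 0 2 3)).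
  move/allbP=> /(_ (e 1 2 3)) /allbP/(_ (e 0 1 4)) /allbP/(_ (e 0 2 4)).
  move/allbP=> /(_ (e 1 2 4)) /allbP/(_ (e 0 3 4)) /allbP/(_ (e 1 3 4)).
  move/allbP=> /(_ (e 2 3 4)); rewrite min.
  move/allbP=> /(_ (e 0 1 5)) /allbP/(_ (e 0 2 5)) /allbP/(_ (e 1 2 5)).
  move/allbP=> /(_ (e 0 3 5)) /allbP/(_ (e 1 3 5)) /allbP/(_ (e 2 3 5)).
  move/allbP=> /(_ (e 0 4 5)) /allbP/(_ (e 1 4 5)) /allbP/(_ (e 2 4 5)).
  by move/allbP=> /(_ (e 3 4 5)).
case/allPn => t tT /negbTE/N.leb_gt lt.
rewrite -(local_form_relabel syme tT); apply: IHn; last exact: relabel_symmetric3.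
lia.
Qed.

(** * Summation over all 6-tuples of vertices *)

Local Open Scope ring_scope.

Lemma big_tuple_cons (R : Type) (idx : R) (op : Monoid.com_law idx) (V : finType)
    (n : nat) (F : n.+1.-tuple V -> R) :
  \big[op/idx]_X F X = \big[op/idx]_x \big[op/idx]_(X : n.-tuple V) F [tuple of x :: X].
Proof.
rewrite pair_big /=.
rewrite (reindex (fun p : V * n.-tuple V => [tuple of p.1 :: p.2])) //=.
exists (fun X => (thead X, [tuple of behead X])) => [[x X] _|X _] /=.
  by congr (_, _); apply/val_inj.
by apply/val_inj; rewrite [in RHS](tuple_eta X).
Qed.

Lemma big_tuple6 (V : finType) (x0 : V) (f : V -> V -> V -> V -> V -> V -> Z) :
  \sum_(X : 6.-tuple V) eval6 f (nth x0 X) =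
  \sum_a \sum_b \sum_c \sum_d \sum_u \sum_v f a b c d u v.
Proof.
do 6![rewrite big_tuple_cons; apply: eq_bigr => ? _].
by rewrite (big_pred1 [tuple]) // => X; rewrite [X]tuple0; apply/esym/eqP.
Qed.

Lemma big_tuple_perm (V : finType) (x0 : V) (s : seq nat)
    (f : V -> V -> V -> V -> V -> V -> Z) : s \in perms6 ->
  \sum_(X : 6.-tuple V) eval6 f (fun i => nth x0 X (nth 0%N s i)) =
  \sum_(X : 6.-tuple V) eval6 f (nth x0 X).
Proof.
rewrite mem_permutations => ps.
pose act (X : 6.-tuple V) := [tuple nth x0 X (nth 0%N s i) | i < 6].
have act_nth X i : (i < 6)%N -> nth x0 (act X) i = nth x0 X (nth 0%N s i).
  move=> i6; have := tnth_mktuple (fun i : 'I_6 => nth x0 X (nth 0%N s i)) (Ordinal i6).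
  by rewrite (tnth_nth x0).
have act_inj : injective act.
  move=> X Y XY; apply/val_inj/(@eq_from_nth _ x0); rewrite ?size_tuple // => i i6.
  have /(nthP 0%N)[j js <-] : i \in s by rewrite (perm_mem ps) mem_iota.
  rewrite (perm_size ps) in js.
  by rewrite -!act_nth // XY.
rewrite [RHS](reindex_inj act_inj); apply: eq_bigr => X _.
by rewrite /eval6 !act_nth.
Qed.

(** Positions holding the same vertex count as distinct points; [local_form_ge0] still applies, as
    it asks only for symmetry. *)
Definition pattern (V : Type) (E : V -> V -> V -> bool) (x0 : V) (X : seq V) i j k :=
  E (nth x0 X i) (nth x0 X j) (nth x0 X k).

(** Permuting coordinates is a bijection of the 6-tuples, so every placement contributes the same
    total. [F] is polymorphic to be read both on positions and on vertices. *)
Lemma sum_pattern (V : finType) (E : V -> V -> V -> bool) (x0 : V)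
    (F : forall I : Type, (I -> I -> I -> bool) -> I -> I -> I -> I -> I -> I -> Z)
    (L : seq (seq nat)) :
  (forall X s, eval6 (F _ (pattern E x0 X)) (nth 0%N s) =
               eval6 (F _ E) (fun i => nth x0 X (nth 0%N s i))) ->
  {subset L <= perms6} ->
  \sum_(X : 6.-tuple V) sum_over L (F _ (pattern E x0 X)) =
  (\sum_a \sum_b \sum_c \sum_d \sum_u \sum_v F _ E a b c d u v) *+ size L.
Proof.
move=> FE LP; rewrite -(big_tuple6 x0).
under eq_bigr => X _ do rewrite sum_overE.
rewrite exchange_big /= big_seq.
under eq_bigr => s sL.
  under eq_bigr => X _ do rewrite FE.
  rewrite big_tuple_perm ?LP //.
  over.
by rewrite -big_seq big_const_seq count_predT iter_addr_0.
Qed.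

(** For fixed [a] and [b] the pairs [xy] and [zw] vary independently, so each product of flags sums
    to a square. *)
Lemma pair_sum_ge0 (V : finType) (E : V -> V -> V -> bool) :
  0 <= \sum_a \sum_b \sum_x \sum_y \sum_z \sum_w pair_term E a b x y z w.
Proof.
apply: sumr_ge0 => a _; apply: sumr_ge0 => b _.
pose S f := \sum_x \sum_y on_four E f a b x y.
suff -> : \sum_x \sum_y \sum_z \sum_w pair_term E a b x y z w =
    S flagW ^+ 2 + 2 * S flagU ^+ 2 + 4 * S flagB ^+ 2.
  by apply: addr_ge0; [apply: addr_ge0|]; rewrite ?sqr_ge0 // mulr_ge0 ?sqr_ge0.
have SS f : S f ^+ 2 = \sum_x \sum_y \sum_z \sum_w
    on_four E f a b x y * on_four E f a b z w.
  rewrite expr2 /S big_distrl; apply: eq_bigr => x _.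
  rewrite big_distrl; apply: eq_bigr => y _.
  by rewrite big_distrr; apply: eq_bigr => z _; rewrite big_distrr.
rewrite !SS !big_distrr -!big_split; apply: eq_bigr => x _ /=.
rewrite !big_distrr -!big_split; apply: eq_bigr => y _ /=.
rewrite !big_distrr -!big_split; apply: eq_bigr => z _ /=.
by rewrite !big_distrr -!big_split; apply: eq_bigr => w _ /=.
Qed.

Lemma quad_sum_ge0 (V : finType) (E : V -> V -> V -> bool) :
  0 <= \sum_p \sum_q \sum_r \sum_s \sum_d \sum_f quad_term E p q r s d f.
Proof.
apply: sumr_ge0 => p _; apply: sumr_ge0 => q _.
apply: sumr_ge0 => r _; apply: sumr_ge0 => s _.
rewrite /quad_term; case: quad_type; last by rewrite big1 // => d _; rewrite big1.
have -> : \sum_d \sum_f (quad_flag E p q r s d * quad_flag E p q r s f)%BZ =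
          (\sum_d quad_flag E p q r s d) ^+ 2.
  by rewrite expr2 big_distrl; apply: eq_bigr => d _; rewrite big_distrr.
exact: sqr_ge0.
Qed.

Lemma size_placements :
  [/\ size five_placements = 6, size pair_placements = 45
    & size quad_placements = 90]%N.
Proof. by split; vm_compute. Qed.

Lemma placements_perms6 :
  [/\ {subset five_placements <= perms6}, {subset pair_placements <= perms6}
    & {subset quad_placements <= perms6}].
Proof. by split=> s; rewrite mem_filter => /andP[]. Qed.

Lemma weightedE (n5 n2 n4 : Z) : weighted n5 n2 n4 = 45 - 12 * n5 - n2 - 6 * n4.
Proof. by []. Qed.

Definition one_edge_count (V : finType) (E : V -> V -> V -> bool) : nat :=
  \sum_a \sum_b \sum_c \sum_d \sum_f one_edge E a b c d f.

Lemma one_edge_count_le (V : finType) (E : V -> V -> V -> bool) :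
  symmetric3 E -> (8 * one_edge_count E <= 5 * #|V| ^ 5)%N.
Proof.
move=> symE.
(* A vertex is needed as the default of [nth]. *)
have [V0|/card_gt0P[x0 _]] := posnP #|V|.
  by rewrite /one_edge_count big1 ?muln0 // => a; have := card0_eq V0 a.
have symP X : symmetric3 (pattern E x0 X).
  by case: symE => s12 s23; split=> i j k; rewrite /pattern.
have : 0 <= \sum_(X : 6.-tuple V) local_form (pattern E x0 X).
  by apply: sumr_ge0 => X _; apply/Z.leb_le/local_form_ge0.
rewrite /local_form; have := size_placements; have := placements_perms6.
move: five_placements pair_placements quad_placements => L5 L2 L4.
move=> [sub5 sub2 sub4] [sz5 sz2 sz4].
under eq_bigr => X _ do rewrite weightedE.
rewrite !sumrB -!mulr_sumr sumr_const card_tuple.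
rewrite (@sum_pattern V E x0 five_term L5) // sz5.
rewrite (@sum_pattern V E x0 pair_term L2) // sz2.
rewrite (@sum_pattern V E x0 quad_term L4) // sz4.
have := pair_sum_ge0 E; have := quad_sum_ge0 E.
set S2 := \sum_a _; set S4 := \sum_a _.
(* The sixth vertex is free and contributes a factor [#|V|], cancelled at the end. *)
have -> : \sum_a \sum_b \sum_c \sum_d \sum_u \sum_v five_term E a b c d u v =
    (one_edge_count E * #|V|)%:R.
  rewrite /one_edge_count natrM natr_sum mulr_suml; apply: eq_bigr => a _.
  rewrite natr_sum mulr_suml; apply: eq_bigr => b _.
  rewrite natr_sum mulr_suml; apply: eq_bigr => c _.
  rewrite natr_sum mulr_suml; apply: eq_bigr => d _.
  rewrite natr_sum mulr_suml; apply: eq_bigr => f _.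
  rewrite sumr_const -[LHS]mulr_natr; congr (_ * _).
  by rewrite /five_term; case: one_edge.
move=> S4_ge0 S2_ge0 H.
have {H} : (72 * (one_edge_count E * #|V|))%:R <= (45 * #|V| ^ 6)%:R :> Z.
  move: H; rewrite -[45 *+ _]mulr_natr (natrM _ 72) (natrM _ 45).
  move: (_ * _)%:R (_ ^ _)%:R => x y; lra.
rewrite ler_nat expnSr !mulnA leq_pmul2r; last by apply/card_gt0P; exists x0.
lia.
Qed.

Local Close Scope ring_scope.

(** * From 5-tuples to 5-subsets *)

(** Made for recursion on the set: [subsets_countU1] unfolds the count on five vertices into 32
    membership tests. *)
Definition subsets_count (V : finType) (P : pred {set V}) (S : {set V}) : nat :=
  #|[set e in powerset S | P e]|.

Lemma subsets_count0 (V : finType) (P : pred {set V}) :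
  subsets_count P set0 = P set0.
Proof.
rewrite /subsets_count powerset0.
case P0: (P set0); last first.
  by apply: eq_card0 => e; rewrite !inE; apply/negP => /andP[/eqP->]; rewrite P0.
rewrite -[RHS](cards1 (set0 : {set V})); apply: eq_card => e; rewrite !inE.
by case: eqP => // ->.
Qed.

Lemma subsets_countU1 (V : finType) (P : pred {set V}) a (S : {set V}) :
  a \notin S ->
  subsets_count P (a |: S) =
  (subsets_count P S + subsets_count (fun e => P (a |: e)) S)%N.
Proof.
move=> aS; rewrite /subsets_count.
rewrite -(cardsID [set e : {set V} | a \notin e]); congr addn.
  apply: eq_card => e; rewrite !inE.
  case Pe: (P e); rewrite ?andbF // !andbT.
  by rewrite -subsetD1 setU1K.
have inj : {in [set e in powerset S | P (a |: e)] &, injective (fun e => a |: e)}.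
  move=> e f; rewrite !inE => /andP[eS _] /andP[fS _] /(congr1 (fun g => g :\ a)).
  by rewrite !setU1K //; apply/negP; [move/(subsetP fS)|move/(subsetP eS)]; rewrite (negbTE aS).
rewrite -(card_in_imset inj); apply: eq_card => e; rewrite !inE negbK.
apply/andP/imsetP => [[ae /andP[eS Pe]]|[f]].
  by exists (e :\ a); rewrite ?inE setD1K // Pe andbT subDset.
rewrite !inE => /andP[fS Pf] ->; split; first by rewrite setU11.
by rewrite setUS.
Qed.

Definition edge_rel (V : finType) (G : three_graph V) (x y z : V) : bool :=
  [set x; y; z] \in edges G.

Lemma edge_rel_symmetric3 (V : finType) (G : three_graph V) :
  symmetric3 (edge_rel G).
Proof.
split=> x y z; rewrite /edge_rel; first by rewrite [[set x; y]]setUC.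
by rewrite -!setUA [[set y] :|: _]setUC.
Qed.

(** Of the 32 subsets, the 22 whose size is not three are not edges; the others are the ten triples
    of [five_row]. *)
Lemma spanned_edges_five (V : finType) (G : three_graph V) a b c d f :
  uniq [:: a; b; c; d; f] ->
  #|spanned_edges G [set x in [:: a; b; c; d; f]]| =
  count id (five_row (edge_rel G) a b c d f f).
Proof.
move=> abcdf.
have -> : [set x in [:: a; b; c; d; f]] = a |: (b |: (c |: (d |: (f |: set0)))).
  by apply/setP => x; rewrite !inE orbF.
have -> : #|spanned_edges G (a |: (b |: (c |: (d |: (f |: set0)))))| =
    subsets_count (fun e => e \in edges G) (a |: (b |: (c |: (d |: (f |: set0))))).
  by apply: eq_card => e; rewrite !inE andbC.
have G3 e : e \in edges G -> #|e| = 3.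
  by move=> eG; have /forall_inP/(_ e eG)/eqP := edges_card3 G.
have not3 (e : {set V}) (s : seq V) : e =i s -> (size s < 3) || (3 < size s) && uniq s ->
    (e \in edges G) = false.
  move=> es s3; apply/negP => /G3; rewrite (eq_card es) => c3.
  case/orP: s3 => [lt|/andP[gt /card_uniqP us]].
    by have := leq_ltn_trans (card_size s) lt; rewrite c3.
  by rewrite us in c3; rewrite c3 in gt.
have e0 : (set0 \in edges G) = false.
  by apply: (not3 _ [::]) => // x; rewrite !inE.
have e1 x : ([set x] \in edges G) = false.
  by apply: (not3 _ [:: x]) => // y; rewrite !inE.
have e2 x y : ([set x; y] \in edges G) = false.
  by apply: (not3 _ [:: x; y]) => // z; rewrite !inE.
have e4 x y z w : uniq [:: x; y; z; w] -> ([set x; y; z; w] \in edges G) = false.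
  by move=> u; apply: (not3 _ [:: x; y; z; w]) => // t; rewrite !inE -!orbA.
have e5 : ([set a; b; c; d; f] \in edges G) = false.
  by apply: (not3 _ [:: a; b; c; d; f]) => // t; rewrite !inE -!orbA.
have u := mask_uniq abcdf.
have e4a := e4 b c d f (u [:: false; true; true; true; true]).
have e4b := e4 a c d f (u [:: true; false; true; true; true]).
have e4c := e4 a b d f (u [:: true; true; false; true; true]).
have e4d := e4 a b c f (u [:: true; true; true; false; true]).
have e4f := e4 a b c d (u [:: true; true; true; true; false]).
move: abcdf => /= /and5P[]; rewrite !inE !negb_or.
move=> /and4P[ab ac ad af] /and3P[bc bd bf] /andP[cd cf] df _.
rewrite !subsets_countU1 ?inE ?negb_or ?orbF ?ab ?ac ?ad ?af ?bc ?bd ?bf ?cd ?cf ?df //.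
rewrite !subsets_count0 !setU0 /edge_rel.
rewrite !setUA e0 !e1 !e2 e5 e4a e4b e4c e4d e4f.
rewrite /= !add0n !addn0; ring.
Qed.

Lemma one_edge_countE (V : finType) (E : V -> V -> V -> bool) (x0 : V) :
  one_edge_count E = \sum_(X : 5.-tuple V)
    one_edge E (nth x0 X 0) (nth x0 X 1) (nth x0 X 2) (nth x0 X 3) (nth x0 X 4).
Proof.
rewrite /one_edge_count.
do 5![rewrite big_tuple_cons; apply: eq_bigr => ? _].
by rewrite (big_pred1 [tuple]) // => X; rewrite [X]tuple0; apply/esym/eqP.
Qed.

(** Each 5-set has 5! = 120 orderings, and a tuple orders at most one set. *)
Lemma e_count_le_one_edge_count (V : finType) (G : three_graph V) :
  120 * e_count 5 1 G <= one_edge_count (edge_rel G).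
Proof.
rewrite /e_count; set good := [set S | _].
have [->|[S0 S0good]] := set_0Vmem good; first by rewrite cards0 muln0.
have [x0 _] : exists x, x \in S0.
  apply/card_gt0P; move: S0good; rewrite inE => /andP[/eqP-> _] //.
rewrite (one_edge_countE _ x0) mulnC -sum_nat_const.
pose R (S : {set V}) (X : 5.-tuple V) := all (mem S) X && uniq X.
have -> : \sum_(S in good) 120 = \sum_(S in good) \sum_(X : 5.-tuple V) R S X.
  apply: eq_bigr => S; rewrite inE => /andP[/eqP S5 _].
  rewrite -(big_mkcond (R S)) sum1_card.
  by have := card_uniq_tuples 5 (mem S); rewrite S5 -[5 ^_ 5]/120 => <-; apply: eq_card => X; rewrite !inE.
rewrite exchange_big /=; apply: leq_sum => X _.
have RX S : S \in good -> R S X -> S = [set x in X] /\ uniq X.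
  rewrite inE => /andP[/eqP S5 _] /andP[/allP XS uX]; split=> //.
  apply/esym/eqP; rewrite eqEcard S5; apply/andP; split.
    by apply/subsetP => x; rewrite inE; apply: XS.
  by rewrite cardsE (card_uniqP uX) size_tuple.
have [/existsP[S /andP[Sgood RSX]]|none] := boolP [exists S, (S \in good) && R S X]; last first.
  rewrite big1 // => S Sgood; case RSX: (R S X) => //.
  by case/negP: none; apply/existsP; exists S; rewrite Sgood.
have [SX uX] := RX _ Sgood RSX.
rewrite (bigD1 S) //= RSX big1 ?addn0 => [|S' /andP[S'good S'S]]; last first.
  case RS'X: (R S' X) => //; have [S'X _] := RX _ S'good RS'X.
  by rewrite S'X SX eqxx in S'S.
move: Sgood; rewrite inE SX => /andP[_ /eqP].
case: X uX {R RX RSX SX} => -[|a [|b [|c [|d [|f []]]]]] // ? /= uX.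
have := spanned_edges_five G uX => ->.
by rewrite /one_edge exactly_oneE => /eqP->.
Qed.

Lemma e_count_le (V : finType) (G : three_graph V) :
  8 * (120 * e_count 5 1 G) <= 5 * #|V| ^ 5.
Proof.
apply: leq_trans (one_edge_count_le (edge_rel_symmetric3 G)).
by rewrite leq_pmul2l // e_count_le_one_edge_count.
Qed.

(** * Complementation *)

Lemma edges_of_pred_card3 (V : finType) (P : pred {set V}) :
  [forall e in [set e : {set V} | (#|e| == 3) && P e], #|e| == 3].
Proof. by apply/forall_inP => e; rewrite inE => /andP[]. Qed.

Definition graph_of_pred (V : finType) (P : pred {set V}) : three_graph V :=
  ThreeGraph (edges_of_pred_card3 P).

Lemma spanned_graph_of_pred (V : finType) (P : pred {set V}) (S : {set V}) :
  spanned_edges (graph_of_pred P) S = [set e : {set V} | [&& e \subset S, #|e| == 3 & P e]].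
Proof. by apply/setP => e; rewrite !inE /= andbC. Qed.

Definition complement (V : finType) (G : three_graph V) : three_graph V :=
  graph_of_pred (fun e => e \notin edges G).

Lemma e_count_complement (V : finType) (k : nat) (G : three_graph V) :
  k <= 10 -> e_count 5 (10 - k) (complement G) = e_count 5 k G.
Proof.
move=> k10; apply: eq_card => S; rewrite !inE.
case: (#|S| =P 5) => //= S5.
(* Each of the 'C(5, 3) = 10 triples in [S] is an edge of exactly one of the two graphs. *)
have : #|spanned_edges G S| + #|spanned_edges (complement G) S| = 10.
  have := cards_draws S 3; rewrite S5 -[X in _ = X]/10 => <-.
  rewrite -[RHS](cardsID (edges G)); congr addn; apply: eq_card => e; last first.
    by rewrite spanned_graph_of_pred !inE andbA andbC.
  rewrite !inE andbC; case eG: (e \in edges G); rewrite ?andbF //=.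
  by have /forall_inP/(_ e eG)-> := edges_card3 G; rewrite !andbT.
by move: #|_| #|_| => x y xy; apply/eqP/eqP; lia.
Qed.

Lemma max_e_count_complement (n : nat) : max_e_count 5 9 n = max_e_count 5 1 n.
Proof.
apply/eqP; rewrite eqn_leq; apply/andP; split; apply/bigmax_leqP => G _.
  by rewrite -(e_count_complement G (isT : 9 <= 10)) leq_bigmax.
by rewrite -(e_count_complement G (isT : 1 <= 10)) leq_bigmax.
Qed.

(** * Two disjoint cliques *)

Definition two_cliques (V : finType) (A : {set V}) : three_graph V :=
  graph_of_pred (fun e => (e \subset A) || (e \subset ~: A)).

Lemma two_cliquesC (V : finType) (A : {set V}) : two_cliques (~: A) = two_cliques A.
Proof. by apply/val_inj/setP => e; rewrite !inE setCK orbC. Qed.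

(** The only edge is [S :&: A]: the two vertices outside [A] are too few for another. *)
Lemma spanned_two_cliques (V : finType) (A S : {set V}) :
  #|S :&: A| = 3 -> #|S :&: ~: A| = 2 -> #|spanned_edges (two_cliques A) S| = 1.
Proof.
move=> SA SB; rewrite -(cards1 (S :&: A)); congr #|pred_of_set _|.
apply/setP => e; rewrite spanned_graph_of_pred !inE.
apply/and3P/eqP => [[eS /eqP e3 /orP[eA|eB]]|->].
- by apply/eqP; rewrite eqEcard subsetI eS eA e3 SA.
- have : #|e| <= #|S :&: ~: A| by rewrite subset_leq_card // subsetI eS.
  by rewrite e3 SB.
- by rewrite SA subsetIl subsetIr.
Qed.

(** The union of a subset of [A] and a subset of its complement determines both, by intersection. *)
Lemma card_split (V : finType) (A : {set V}) (i j : nat) :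
  'C(#|A|, i) * 'C(#|~: A|, j) <=
  #|[set S : {set V} | (#|S :&: A| == i) && (#|S :&: ~: A| == j)]|.
Proof.
rewrite -!cards_draws -cardsX.
set D := setX _ _; pose u (p : {set V} * {set V}) := p.1 :|: p.2.
have uA p : p \in D -> u p :&: A = p.1 /\ u p :&: ~: A = p.2.
  case: p => P Q; rewrite !inE /= => /andP[/andP[PA _] /andP[QA _]].
  rewrite !setIUl (setIidPl PA) (setIidPl QA).
  by rewrite !disjoint_setI0 ?setU0 ?set0U // disjoints_subset ?setCK.
have inj : {in D &, injective u}.
  by move=> p q /uA[p1 p2] /uA[q1 q2] pq; move: p1 p2; rewrite pq q1 q2;
     case: p q {q1 q2 pq} => [? ?] [? ?] /= -> ->.
rewrite -(card_in_imset inj); apply/subset_leq_card/subsetP => S /imsetP[p pD ->].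
have [p1 p2] := uA _ pD; rewrite inE p1 p2.
by move: pD; rewrite !inE => /andP[/andP[_ ->] /andP[_ ->]].
Qed.

Lemma e_count_two_cliques (V : finType) (A : {set V}) :
  'C(#|A|, 3) * 'C(#|~: A|, 2) + 'C(#|A|, 2) * 'C(#|~: A|, 3)
  <= e_count 5 1 (two_cliques A).
Proof.
apply: leq_trans (leq_add (card_split A 3 2) (card_split A 2 3)) _.
(* The 3-2 and 2-3 splits are disjoint families. *)
rewrite -cardsUI [X in _ + #|pred_of_set X|](_ : _ = set0) ?cards0 ?addn0; last first.
  by apply/setP => S; rewrite !inE; case: (#|S :&: A| =P 3) => [->|]; rewrite ?andbF.
apply/subset_leq_card/subsetP => S; rewrite !inE.
have -> : #|S| = #|S :&: A| + #|S :&: ~: A| by rewrite -setDE cardsID.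
case/orP=> /andP[/eqP SA /eqP SB]; rewrite SA SB /=.
  by rewrite spanned_two_cliques.
by rewrite -two_cliquesC spanned_two_cliques // setCK.
Qed.

Lemma max_e_count_ge (n : nat) :
  2 * ('C(n./2, 3) * 'C(n./2, 2)) <= max_e_count 5 1 n.
Proof.
pose A := [set i : 'I_n | i < n./2].
have cA : #|A| = n./2.
  have hn : n./2 <= n by rewrite -{2}(odd_double_half n) -addnn; lia.
  by rewrite -sum1dep_card -(big_ord_widen n (fun=> 1) hn) sum1_card card_ord.
have cB : n./2 <= #|~: A| by have := cardsC A; rewrite card_ord cA; lia.
apply: leq_trans (leq_bigmax (two_cliques A)).
apply: leq_trans (e_count_two_cliques A); rewrite cA mulSn mul1n.
have l2 := leq_bin2l 2 cB; have l3 := leq_bin2l 3 cB.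
by apply: leq_add; [|rewrite mulnC]; apply: leq_mul.
Qed.

(** * The limit *)

From mathcomp Require Import all_classical all_reals all_analysis.
Import numFieldNormedType.Exports.

(** For positive [n], the factors on the right are [k], ..., [k + n.-1]. *)
Lemma expn_leq_ffact (k n : nat) : k ^ n <= (k + n.-1) ^_ n.
Proof.
elim: n k => [|n IHn] k; first by rewrite ffactn0.
rewrite ffactnS expnS leq_mul ?leq_addr //=.
by case: n IHn => [|n] IHn; rewrite ?ffactn0 // addnS.
Qed.

Lemma ffact_leq_expn (n m : nat) : n ^_ m <= n ^ m.
Proof.
elim: m => [|m IHm]; first by rewrite ffactn0.
by rewrite ffactnSr expnSr leq_mul // leq_subr.
Qed.

(** Two cliques give about 2 (n/2)^3 / 6 * (n/2)^2 / 2 = n^5 / 192, against n^5 / 120 for all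
    5-sets; 120 / 192 and 5 * 120 / 960 both equal 5 / 8. *)
Lemma max_e_count_bounds (k : nat) :
  [/\ k ^ 5 <= 192 * max_e_count 5 1 (k + 5),
      960 * max_e_count 5 1 (k + 5) <= 5 * (k + 5) ^ 5,
      k.+1 ^ 5 <= 120 * 'C(k + 5, 5)
    & 120 * 'C(k + 5, 5) <= (k + 5) ^ 5].
Proof.
have C5 : 120 * 'C(k + 5, 5) = (k + 5) ^_ 5 by rewrite -bin_ffact mulnC.
split; rewrite ?C5.
- have := max_e_count_ge (k + 5); set h := _./2; set M := max_e_count _ _ _ => hM.
  have [g hg] : exists g, h = g.+2.
    by exists h.-2; rewrite /h; lia.
  (* Here k + 5 <= 2 h + 1 = 2 g + 5, which is why the shift is by 5. *)
  have kg : k <= 2 * g by have : k + 5 <= h.*2.+1; rewrite /h ?hg; lia.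
  have h3 : g ^ 3 <= 'C(h, 3) * 6.
    by rewrite -[6]/(3`!) bin_ffact hg; have := expn_leq_ffact g 3; rewrite addn2.
  have h2 : g ^ 2 <= 'C(h, 2) * 2.
    rewrite -['C(h, 2) * 2]/('C(h, 2) * 2`!) bin_ffact hg.
    apply: (@leq_trans (g.+1 ^ 2)); first by rewrite leq_exp2r.
    by have := expn_leq_ffact g.+1 2; rewrite addn1.
  apply: (@leq_trans ((2 * g) ^ 5)); first by rewrite leq_exp2r.
  apply: (@leq_trans (192 * (2 * ('C(h, 3) * 'C(h, 2))))); last by rewrite leq_pmul2l.
  have -> : 192 * (2 * ('C(h, 3) * 'C(h, 2))) = 32 * (('C(h, 3) * 6) * ('C(h, 2) * 2)).
    by ring.
  have -> : (2 * g) ^ 5 = 32 * (g ^ 3 * g ^ 2) by rewrite expnMn -expnD.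
  by rewrite leq_pmul2l // leq_mul.
- rewrite mulnC -leq_divRL //; apply/bigmax_leqP => G _.
  rewrite leq_divRL // mulnC -[960]/(8 * 120) -mulnA.
  by have := e_count_le G; rewrite card_ord.
- by have := expn_leq_ffact k.+1 5; rewrite addSnnS.
- exact: ffact_leq_expn.
Qed.

Local Open Scope classical_set_scope.
Local Open Scope ring_scope.

Lemma max_density_cvg (R : realType) : max_density R 5 1 @ \oo --> (5 / 8 : R).
Proof.
rewrite -(cvg_shiftn 5).
(* As [harmonic k] is 1 / (k + 1), the bounds are 5 / 8 times the fifth powers of k / (k + 5) and (k
   + 5) / (k + 1). *)
pose l (k : nat) : R := 5 / 8 * (1 - 5 * harmonic (k + 4)%N) ^+ 5.
pose u (k : nat) : R := 5 / 8 * (1 + 4 * harmonic k) ^+ 5.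
have bounds (k : nat) : l k <= max_density R 5 1 (k + 5)%N <= u k.
  have [lM uM lC uC] := max_e_count_bounds k; rewrite /max_density.
  have C0 : 0 < ('C(k + 5, 5)%:R : R) by rewrite ltr0n bin_gt0 leq_addl.
  have n0 : 0 < ((k + 5)%:R : R) by rewrite ltr0n addn_gt0 orbT.
  have k0 : 0 < (k.+1%:R : R) by rewrite ltr0n.
  have M0 : 0 <= ((max_e_count 5 1 (k + 5))%:R : R) by rewrite ler0n.
  move: lM uM lC uC; rewrite -!(ler_nat R) !(natrM, natrX).
  have -> : l k = 5 / 8 * (k%:R ^+ 5 / (k + 5)%:R ^+ 5).
    rewrite /l /harmonic /= -addnS -expr_div_n; congr (_ * _ ^+ _).
    by rewrite natrD; field; rewrite -natrD gt_eqF.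
  have -> : u k = 5 / 8 * ((k + 5)%:R ^+ 5 / k.+1%:R ^+ 5).
    rewrite /u /harmonic /= -expr_div_n; congr (_ * _ ^+ _).
    by rewrite natrD -natr1; field; rewrite lt0r_neq0 //; move: k0; rewrite -natr1; lra.
  move: (exprn_gt0 5 n0) (exprn_gt0 5 k0).
  move: (max_e_count 5 1 (k + 5))%:R ('C(k + 5, 5))%:R M0 C0 => M C M0 C0.
  move: (k%:R ^+ 5) ((k + 5)%:R ^+ 5) (k.+1%:R ^+ 5) => K5 N5 S5 N0 S0 lM uM lC uC.
  rewrite ler_pdivlMr // ler_pdivrMr //; apply/andP; split.
    rewrite !mulrA mulrAC ler_pdivrMr //.
    (* The constants meet since 5 / 8 * 192 = 120. *)
    apply: (@le_trans _ _ (M * (120 * C))); last by rewrite ler_wpM2l.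
    by rewrite mulrCA mulrA ler_wpM2r ?(ltW C0) //; lra.
  rewrite !mulrA mulrAC ler_pdivlMr //.
  apply: (@le_trans _ _ (M * (120 * C))); first by rewrite ler_wpM2l.
  by rewrite mulrCA mulrA ler_wpM2r ?(ltW C0) //; lra.
have lim0 (c : R) (v : R^nat) : v @ \oo --> (0 : R) ->
    (fun k => 5 / 8 * (1 + c * v k) ^+ 5) @ \oo --> (5 / 8 : R).
  move=> v0; rewrite [X in _ --> X](_ : _ = 5 / 8 * (1 + c * 0) ^+ 5); last first.
    by rewrite mulr0 addr0 expr1n mulr1.
  apply: cvgMl_tmp; apply: (@cvg_comp _ _ _ _ (fun x : R => x ^+ 5)); last exact: exprn_continuous.
  by apply: cvgD; [exact: cvg_cst | exact: cvgMl_tmp].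
apply: (@squeeze_cvgr _ _ _ _ l u); first by apply: nearW => k; apply: bounds.
  have -> : l = fun k : nat => 5 / 8 * (1 + (-5) * harmonic (k + 4)%N) ^+ 5.
    by apply/funext => k; rewrite mulNr.
  by apply: lim0; rewrite (cvg_shiftn 4 (@harmonic R)); exact: cvg_harmonic.
by apply: lim0; exact: cvg_harmonic.
Qed.

Theorem theorem2p31 (R : realType) :
  pi_empty R 5 1 = 5 / 8 /\ pi_empty R 5 9 = 5 / 8.
Proof.
have dE : max_density R 5 9 = max_density R 5 1.
  by apply/funext => n; rewrite /max_density max_e_count_complement.
by rewrite /pi_empty dE; split; apply/cvg_lim => //; exact: max_density_cvg.
Qed.
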